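(* Let $(a_n,b_n)$, $n\ge1$, be the $P$-positions $(x,y)$ with $0<x\le y$ of Corner the Queen Bee, listed so that $a_1<a_2<\cdots$. Then the sequence $a_{b_n}-a_n-b_n$ ($n\ge1$) is unbounded.
   Context: Positions are pairs $(x,y)$ of nonnegative integers. From $(x,y)$ the Queen Bee may move to: (i) $(x',y)$ with $0\le x'<x$, or $(x,y')$ with $0\le y'<y$; (ii) $(x-s,y-s)$ with $1\le s\le\min(x,y)$; (iii) if $x<y$, to $(t,y-x)$ with $0<t<2x$; if $x>y$, to $(x-y,t)$ with $0<t<2y$. Every move strictly decreases $x+y$. $P$-positions: $(0,0)$ is a $P$-position, and a position is a $P$-position iff it has no move to a $P$-position. *)

(* Defs.v *)
From Stdlib Require Import Wellfounded.
From Stdlib Require Import Classical ClassicalEpsilon.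
From mathcomp Require Import all_boot.
From mathcomp Require Import zify.
Set Implicit Arguments.
Unset Strict Implicit.
Unset Printing Implicit Defensive.

Inductive bee_move : nat * nat -> nat * nat -> Prop :=
| move_left x x' y : x' < x -> bee_move (x, y) (x', y)
| move_down x y y' : y' < y -> bee_move (x, y) (x, y')
| move_diag x y s : 1 <= s <= minn x y -> bee_move (x, y) (x - s, y - s)
| move_above x y t : x < y -> 0 < t < 2 * x -> bee_move (x, y) (t, y - x)
| move_below x y t : y < x -> 0 < t < 2 * y -> bee_move (x, y) (x - y, t).

Lemma bee_move_decr p q : bee_move p q -> q.1 + q.2 < p.1 + p.2.
Proof. by case=> /= *; lia. Qed.

Lemma bee_move_wf : well_founded (fun q p => bee_move p q).
Proof.
apply: (wf_incl _ _ (fun q p : nat * nat => (q.1 + q.2 < p.1 + p.2)%coq_nat)).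
  by move=> q p /bee_move_decr/ltP.
exact: (wf_inverse_image _ _ lt (fun p : nat * nat => p.1 + p.2) Wf_nat.lt_wf).
Qed.

(* Well-founded recursion along moves; [PposE] is the defining property. *)
Definition Ppos : nat * nat -> Prop :=
  Fix bee_move_wf (fun _ => Prop)
    (fun p rec => ~ exists q, exists pq : bee_move p q, rec q pq).

Lemma PposE p : Ppos p <-> ~ exists2 q, bee_move p q & Ppos q.
Proof.
pose F p (rec : forall q, bee_move p q -> Prop) :=
  ~ exists q, exists pq : bee_move p q, rec q pq.
have irr : forall r (A A' : Acc (fun q p => bee_move p q) r),
    Fix_F (fun _ => Prop) F A <-> Fix_F (fun _ => Prop) F A'.
  move=> r; elim/(well_founded_ind bee_move_wf): r => r IH A A'.
  rewrite -(Fix_F_eq _ F A) -(Fix_F_eq _ F A') /F.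
  by split=> H [q [rq Pq]]; apply: H; exists q, rq;
    move: Pq; apply: (proj1 (IH _ rq _ _)).
rewrite /Ppos /Fix -(Fix_F_eq _ F (bee_move_wf p)) {1}/F.
split=> H.
  case=> q pq Pq; apply: H; exists q, pq; exact: (proj1 (irr _ _ _) Pq).
case=> q [pq Pq]; apply: H; exists q => //; exact: (proj1 (irr _ _ _) Pq).
Qed.

(* Sequences are indexed from 1; the values [a 0] and [b 0] are junk. *)
Definition lists_Ppos (a b : nat -> nat) : Prop :=
  (forall m n, 0 < m -> m < n -> a m < a n) /\
  (forall x y, Ppos (x, y) /\ 0 < x <= y <->
     exists2 n, 0 < n & (x, y) = (a n, b n)).

Lemma Ppos00 : Ppos (0, 0).
Proof. by apply/PposE => -[q /bee_move_decr]. Qed.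

Lemma Ppos_stuck p q : Ppos p -> bee_move p q -> ~ Ppos q.
Proof. by move/PposE=> H pq Pq; apply: H; exists q. Qed.

Lemma Ppos_col x y y' : Ppos (x, y) -> Ppos (x, y') -> y = y'.
Proof.
move=> P P'; case: (ltngtP y y') => // lt.
  by case: (Ppos_stuck P' (move_down x lt) P).
by case: (Ppos_stuck P (move_down x lt) P').
Qed.

Lemma bee_move_sym p q : bee_move p q -> bee_move (p.2, p.1) (q.2, q.1).
Proof.
case=> /= x y z *.
- exact: move_down.
- exact: move_left.
- by apply: move_diag; rewrite minnC.
- exact: move_below.
- exact: move_above.
Qed.

Lemma Ppos_sym x y : Ppos (x, y) -> Ppos (y, x).
Proof.
suff H : forall p, Ppos p <-> Ppos (p.2, p.1) by move/H.
move=> p; elim/(well_founded_ind bee_move_wf): p => p IH.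
rewrite (PposE p) (PposE (p.2, p.1)); split=> H [q pq Pq]; apply: H.
  have pq' := bee_move_sym pq; rewrite /= -surjective_pairing in pq'.
  by exists (q.2, q.1) => //; apply/IH => //=; rewrite -surjective_pairing.
exists (q.2, q.1); first exact: bee_move_sym.
exact: (proj1 (IH q pq)).
Qed.

Lemma Ppos_bounded N :
  exists M, forall x y, x <= N -> Ppos (x, y) -> y <= M.
Proof.
have col x : exists M, forall y, Ppos (x, y) -> y <= M.
  case: (classic (exists y, Ppos (x, y))) => [[y Py]|none].
    by exists y => y' /(Ppos_col Py) <-.
  by exists 0 => y Py; case: none; exists y.
elim: N => [|N [M HM]].
  by have [M HM] := col 0; exists M => x y; rewrite leqn0 => /eqP -> /HM.
have [M' HM'] := col N.+1; exists (maxn M M') => x y.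
by rewrite leq_eqVlt => /predU1P[-> /HM'|xN /(HM _ _ xN)]; lia.
Qed.

Lemma Ppos_total x : exists y, Ppos (x, y).
Proof.
have [M HM] := Ppos_bounded (2 * x).
apply: NNPP => none; apply: (none).
exists (M + x).+1; apply/PposE => -[q mv Pq].
move Ep: (x, (M + x).+1) mv => p mv; case: mv Ep Pq.
- by move=> x1 x' y lt [? ?] /HM; lia.
- by move=> x1 y y' lt [? ?] Pq; subst; apply: none; exists y'.
- by move=> x1 y s lt [? ?] /HM; lia.
- by move=> x1 y t lt ht [? ?] /HM; lia.
- by move=> x1 y t lt ht [? ?]; lia.
Qed.

Lemma Ppos_infinite N : exists x y, [/\ N < x, x <= y & Ppos (x, y)].
Proof.
have [M HM] := Ppos_bounded N.
pose x := (maxn M N).+1; have [y Py] := Ppos_total x.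
case: (leqP x y) => xy; first by exists x, y; split=> //; lia.
have Qy := Ppos_sym Py; exists y, x; split=> //; last exact: ltnW.
by case: (ltnP N y) => // yN; have := HM _ _ yN Qy; lia.
Qed.

Lemma lists_Ppos_exists : exists a b, lists_Ppos a b.
Proof.
pose S x := exists y, Ppos (x, y) /\ x <= y.
pose Sb N x : bool :=
  (N < x) && (if excluded_middle_informative (S x) then true else false).
have SbP N x : reflect (N < x /\ S x) (Sb N x).
  rewrite /Sb; case: excluded_middle_informative => s; rewrite ?andbT ?andbF.
    by apply: (iffP idP) => [|[]].
  by constructor; case.
have ex N : exists x, Sb N x.
  have [x [y [Nx xy P]]] := Ppos_infinite N.
  by exists x; apply/SbP; split=> //; exists y.
pose nxt N := ex_minn (ex N); pose a n := iter n nxt 0.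
have nxtP N : [/\ N < nxt N, S (nxt N) & forall x, N < x -> S x -> nxt N <= x].
  rewrite /nxt; case: ex_minnP => m /SbP[Nm Sm] min; split=> // x Nx Sx.
  by apply: min; apply/SbP.
have aS n : a n < a n.+1 by have [] := nxtP (a n).
have amono : {homo a : m n / m < n} by apply: homo_ltn => //; apply: ltn_trans.
have an n : n <= a n by elim: n => // n /leq_ltn_trans; apply.
pose b n := proj1_sig (constructive_indefinite_description _ (Ppos_total (a n))).
have bP n : Ppos (a n, b n).
  by rewrite /b; case: constructive_indefinite_description.
exists a, b; split=> [m n _ /amono //|x y]; split.
  case=> P /andP[x0 xy]; have Sx : S x by exists y.
  have exn : exists n, x <= a n by exists x.
  case: (ex_minnP exn) => -[|n] xan min; first by move: xan; rewrite /a /=; lia.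
  have lt : a n < x by rewrite ltnNge; apply/negP => /min; lia.
  have Ex : x = a n.+1.
    by apply/eqP; rewrite eqn_leq xan /=; have [_ _] := nxtP (a n); apply.
  exists n.+1 => //; congr pair => //; apply: (@Ppos_col x) => //.
  by rewrite Ex.
case=> -[|n] // _ [-> ->]; have [lt [y' [P' le]] _] := nxtP (a n).
split; first exact: (bP n.+1).
apply/andP; split; first exact: (leq_ltn_trans _ (aS n)).
by rewrite (Ppos_col (bP n.+1) P').
Qed.

Lemma lists_Ppos_unique a b a' b' : lists_Ppos a b -> lists_Ppos a' b' ->
  forall n, 0 < n -> (a n, b n) = (a' n, b' n).
Proof.
have half c d c' d' : lists_Ppos c d -> lists_Ppos c' d' ->
    forall n, 0 < n -> (forall m, 0 < m < n -> c m = c' m) -> c' n <= c n.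
  move=> [inc Lc] [inc' Lc'] n n0 IH.
  have /Lc/Lc'[m m0 [E _]] : exists2 k, 0 < k & (c n, d n) = (c k, d k).
    by exists n.
  case: (ltngtP m n) => mn; rewrite E.
  - have := inc m n m0 mn; rewrite E (IH m) ?m0 //; lia.
  - exact/ltnW/inc'.
  - by rewrite mn.
move=> L L' n n0.
have Ea : a n = a' n.
  elim/ltn_ind: n n0 => n IH n0; apply/eqP; rewrite eqn_leq.
  rewrite (half _ _ _ _ L' L) ?(half _ _ _ _ L L') // => m /andP[m0 mn].
    by rewrite IH.
  by rewrite IH.
have P : Ppos (a n, b n) by apply: proj1; apply/(proj2 L); exists n.
have P' : Ppos (a' n, b' n) by apply: proj1; apply/(proj2 L'); exists n.
by rewrite -Ea in P' *; rewrite (Ppos_col P P').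
Qed.

(* Main.v *)
(** Call a positive integer evenly divisible if its 2-adic valuation is even.
    The nonzero P-positions are exactly the pairs (x, 2x) and (2x, x) with x
    evenly divisible.  Hence a enumerates these integers, b_n = 2 a_n, and for
    m = a_n the sequence in question is a_{2m} - 3m.  The number A(x) of evenly
    divisible integers in [1, x] satisfies A(2x) = 2x - A(x), so that
    3 A(x) - 2x is the number of digits 1 minus the number of digits 2 in base
    4.  Taking 3m = 11...1 in base 4, with 3j digits, gives A(3m) = 2m + j, so
    a_{2m} <= 3m - j. *)

Require Import Defs.
From mathcomp Require Import all_boot all_order all_algebra.
From mathcomp Require Import zify.
Set Implicit Arguments.
Unset Strict Implicit.
Unset Printing Implicit Defensive.

Import Order.TTheory GRing.Theory Num.Theory.

Definition even_val (x : nat) : bool := (0 < x) && ~~ odd (logn 2 x).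

Lemma even_val_odd x : odd x -> even_val x.
Proof.
move=> ox; rewrite /even_val lognE dvdn2 ox andbF andbT.
by case: x ox.
Qed.

Lemma even_val_double x : 0 < x -> even_val (2 * x) = ~~ even_val x.
Proof.
by move=> x0; rewrite /even_val muln_gt0 x0 /= lognM // logn_prime //= negbK.
Qed.

Lemma not_even_val x : 0 < x -> ~~ even_val x ->
  exists2 z, even_val z & x = 2 * z.
Proof.
move=> x0 ex; have E : x = 2 * x./2.
  by rewrite mul2n even_halfK //; apply: contra ex; apply: even_val_odd.
exists x./2 => //; move: x0 ex; rewrite {1 2}E muln_gt0 => /andP[_ h0].
by rewrite even_val_double // negbK.
Qed.

Lemma even_val_doubleF x : even_val x -> even_val (2 * x) = false.
Proof. by move=> ex; rewrite even_val_double ?ex //; case/andP: ex. Qed.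

(** A kernel in the graph sense: no move joins two of its members, and every other position has a
    move into it. *)
Definition bee_kernel (p : nat * nat) : Prop :=
  [\/ p = (0, 0), even_val p.1 /\ p.2 = 2 * p.1 | even_val p.2 /\ p.1 = 2 * p.2].

Lemma bee_kernel_sym p : bee_kernel p -> bee_kernel (p.2, p.1).
Proof. by case: p => x y [[-> ->]|?|?]; [apply: Or31|apply: Or33|apply: Or32]. Qed.

(** From [(x, 2x)], a diagonal move keeps the difference [x], which fixes the pair. The columnwise
    and type (iii) moves could only meet a pair made of [x] and its half, but that half is not
    evenly divisible. *)
Lemma bee_kernel_stuck p q : bee_move p q -> bee_kernel p -> ~ bee_kernel q.
Proof.
have half x y q' : bee_move (x, y) q' -> even_val x -> y = 2 * x ->
    ~ bee_kernel q'.
  move=> mv ex Ey; have x0 : 0 < x by case/andP: ex.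
  have dbl z : even_val z -> x <> 2 * z.
    by move=> /even_val_doubleF ez Ex; rewrite Ex ez in ex.
  move Ep: (x, y) mv => p' mv; case: mv Ep =>
    [u u' v lt|u v v' lt|u v s lt|u v t lt ht|u v t lt ht] [? ?]; subst u v.
  - by case=> /= [[]|[]|[]]; lia.
  - by case=> /= [[]|[]|[] /dbl]; lia.
  - by case=> /= [[]|[]|[]]; lia.
  - by case=> /= [[]|[] /dbl|[]]; lia.
  - lia.
move=> mv; case: p mv => x y mv [[Ex Ey]|[/= ex Ey]|[/= ey Ex]].
- by move/bee_move_decr: mv; rewrite Ex Ey.
- exact: half mv ex Ey.
- by move/bee_kernel_sym; apply: half (bee_move_sym mv) ey Ex.
Qed.

Lemma bee_kernel_reach p : bee_kernel p \/ exists2 q, bee_move p q & bee_kernel q.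
Proof.
have half x y : x <= y ->
    bee_kernel (x, y) \/ exists2 q, bee_move (x, y) q & bee_kernel q.
  case: (posnP x) => [->|x0 xy].
    case: (posnP y) => [->|y0 _]; first by left; apply: Or31.
    by right; exists (0, 0); [apply: move_down|apply: Or31].
  case: (boolP (even_val x)) => [ex|/(not_even_val x0)[z ez Ex]]; last first.
    right; exists (x, z); last exact: Or33.
    by apply: move_down; lia.
  case: (ltngtP y (2 * x)) => [lt|gt|->]; last by left; apply: Or32.
    right; case: (posnP (y - x)) => [d0|d0].
      have -> : y = x by lia.
      exists (x - x, x - x); first by apply: move_diag; rewrite minnn; lia.
      by rewrite subnn; apply: Or31.
    (* Now [x < y < 2x]. With [d = y - x], the target is the diagonal's [(d, 2d)], or else [(z, 2z)]
       with [d = 2z], by a type (iii) move. *)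
    case: (boolP (even_val (y - x))) => [ed|/(not_even_val d0)[z ez Ed]].
      exists (x - (2 * x - y), y - (2 * x - y)).
        by apply: move_diag; lia.
      by apply: Or32; rewrite /= (_ : x - _ = y - x); last lia; split; last lia.
    have z0 : 0 < z by case/andP: ez.
    by exists (z, y - x); [apply: move_above; lia|apply: Or32].
  by right; exists (x, 2 * x); [apply: move_down|apply: Or32].
case: p => x y; case: (leqP x y) => [|/ltnW] /half // [/bee_kernel_sym|[q]].
  by left.
by move=> /bee_move_sym mv /bee_kernel_sym; right; exists (q.2, q.1).
Qed.

Lemma PposP p : Ppos p <-> bee_kernel p.
Proof.
elim/(well_founded_ind bee_move_wf): p => p IH; rewrite PposE; split.
  move=> H; case: (bee_kernel_reach p) => // -[q mv Kq].
  by case: H; exists q => //; apply/IH.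
by move=> Kp [q mv /(IH q mv)]; apply: bee_kernel_stuck Kp.
Qed.

Lemma lists_Ppos_nth a b n : lists_Ppos a b -> 0 < n ->
  even_val (a n) /\ b n = 2 * a n.
Proof.
case=> _ L n0; have [|/PposP K /andP[x0 xy]] := proj2 (L (a n) (b n)).
  by exists n.
by case: K => [[]|//|/= []]; lia.
Qed.

Lemma lists_Ppos_index a b x : lists_Ppos a b -> even_val x ->
  exists2 n, 0 < n & a n = x.
Proof.
case=> _ L ex; have x0 : 0 < x by case/andP: ex.
have [|n n0 [-> _]] := proj1 (L x (2 * x)); last by exists n.
by split; [apply/PposP/Or32|lia].
Qed.

Definition nb_even_val (x : nat) : nat := count even_val (iota 1 x).

Lemma nb_even_valD x y :
  nb_even_val (x + y) = nb_even_val x + count even_val (iota x.+1 y).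
Proof. by rewrite /nb_even_val iotaD count_cat add1n. Qed.

Lemma nb_even_valS x : nb_even_val x.+1 = nb_even_val x + even_val x.+1.
Proof. by rewrite -addn1 nb_even_valD /= addn0 addn1. Qed.

(** Odd numbers always count, and exactly one of [k] and [2k] counts. *)
Lemma nb_even_val_double x : nb_even_val (2 * x) + nb_even_val x = 2 * x.
Proof.
elim: x => // x IH; rewrite (_ : 2 * x.+1 = (2 * x).+2); last lia.
rewrite !nb_even_valS even_val_odd; last by rewrite /= oddM.
rewrite (_ : (2 * x).+2 = 2 * x.+1); last lia.
by rewrite even_val_double //; case: even_val => /=; lia.
Qed.

(** Effect of appending a digit 1 in base 4: doubling twice gives the count [2x] more at [4x], and
    [4x + 1] is odd. *)
Lemma nb_even_val_digit1 x :
  nb_even_val (4 * x).+1 = nb_even_val x + (2 * x).+1.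
Proof.
rewrite nb_even_valS even_val_odd; last by rewrite /= oddM.
have := nb_even_val_double x; have := nb_even_val_double (2 * x).
by rewrite (_ : 2 * (2 * x) = 4 * x); lia.
Qed.

(* (64 ^ j - 1) / 9, a third of the base 4 number 11...1 with 3j digits. *)
Fixpoint repunit_third (j : nat) : nat :=
  if j is i.+1 then 64 * repunit_third i + 7 else 0.

Lemma nb_even_val_repunit_third j :
  nb_even_val (3 * repunit_third j) = 2 * repunit_third j + j.
Proof.
elim: j => // j IH /=; set m := repunit_third j in IH *.
(* Three digits 1 are appended to [3m]. *)
rewrite (_ : 3 * _ = (4 * (4 * (4 * (3 * m)).+1).+1).+1); last lia.
by rewrite !nb_even_val_digit1 IH; lia.
Qed.

(** By monotonicity, each evenly divisible integer up to [a n] is some [a k] with [k <= n]. *)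
Lemma nb_even_val_nth a b n : lists_Ppos a b -> 0 < n -> nb_even_val (a n) <= n.
Proof.
move=> L n0; rewrite /nb_even_val -size_filter -[leqRHS](size_iota 1).
rewrite -[leqRHS](size_map a); apply: uniq_leq_size.
  by rewrite filter_uniq ?iota_uniq.
move=> x; rewrite mem_filter mem_iota => /andP[/(lists_Ppos_index L)[k k0 <-]] lt.
apply: map_f; rewrite mem_iota k0 /= add1n ltnS leqNgt; apply/negP => nk.
by have := proj1 L n k n0 nk; lia.
Qed.

(** The count is at most [n] at [a n] and grows by at most 1 per integer, so [j] further hits
    require [j] further integers. *)
Lemma lists_Ppos_nth_le a b n x j : lists_Ppos a b -> 0 < n ->
  n + j <= nb_even_val x -> a n + j <= x.
Proof.
move=> L n0 le; have := nb_even_val_nth L n0.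
case: (leqP (a n) x) => [ax|].
  move: le; rewrite -{1}(subnKC ax) nb_even_valD.
  have := count_size even_val (iota (a n).+1 (x - a n)).
  by rewrite size_iota; lia.
(* If [x < a n], the count at [x] misses [a n] itself, so it is below [n], a contradiction. *)
have [en _] := lists_Ppos_nth L n0; case: (a n) en => // c ec xc.
rewrite nb_even_valS ec -(subnKC (xc : x <= c)) nb_even_valD.
lia.
Qed.

Local Open Scope ring_scope.

Theorem theorem4 (a b : nat -> nat) (hab : lists_Ppos a b) :
  forall B : nat, exists n : nat, (0 < n)%N /\
    B%:Z < `|(a (b n))%:Z - (a n)%:Z - (b n)%:Z|.
Proof.
move=> B; pose m := repunit_third B.+1.
(* Oddness makes [m] evenly divisible, hence a term of [a]. *)
have om : odd m by rewrite /m /= oddD oddM.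
have [n n0 an] := lists_Ppos_index hab (even_val_odd om).
have [_ bn] := lists_Ppos_nth hab n0; rewrite an in bn.
have m0 : (0 < 2 * m)%N by rewrite muln_gt0; case: (m) om.
(* Since [a n + b n = 3m], the difference is at most [-(B + 1)]. *)
have le : (a (2 * m) + B.+1 <= 3 * m)%N.
  by apply: lists_Ppos_nth_le hab m0 _; rewrite nb_even_val_repunit_third.
by exists n; split=> //; rewrite bn an; lia.
Qed.
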